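(* Consider the in-distribution case $(\Sigma_0,\beta_0)=(\Sigma,\beta)$, let $\mathscr R(\lambda,\phi)$ be the deterministic risk equivalent defined in the context, and let $\lambda^*\in\arg\min_{\lambda\ge\lambda_{\min}(\phi)}\mathscr R(\lambda,\phi)$. (1) (Underparameterized) If $\phi<1$, then $\lambda^*\ge0$. (2) (Overparameterized) If $\phi>1$ and, with $B=\beta\beta^\top$, for all $0<v<1/\mu(0,\phi)$, $$\frac{\overline{\mathrm{tr}}[B\Sigma(v\Sigma+I)^{-2}]+\sigma^2}{\overline{\mathrm{tr}}[B\Sigma(v\Sigma+I)^{-3}]+\sigma^2}>\frac{\overline{\mathrm{tr}}[\Sigma(v\Sigma+I)^{-2}]}{\overline{\mathrm{tr}}[\Sigma(v\Sigma+I)^{-3}]},$$ then $\lambda^*<0$.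
   Context: Notation: $\overline{\mathrm{tr}}[A]=\mathrm{tr}[A]/p$ for $A\in\mathbb R^{p\times p}$. Parameters: $\Sigma,\Sigma_0\in\mathbb R^{p\times p}$ are deterministic symmetric matrices with eigenvalues bounded away from $0$ and $+\infty$ (uniformly in $p$), the feature covariances of the train and test distributions; $\beta,\beta_0\in\mathbb R^p$ are the $L_2$ linear projection coefficients of the train and test responses on the features; $\sigma^2,\sigma_0^2\ge 0$ are the corresponding noise variances; $\phi\in(0,\infty)$ is the limit of $p/n$. Let $r_{\min}$ be the smallest eigenvalue of $\Sigma$. Let $\mu_{\min}>-r_{\min}$ be the unique solution of $1=\phi\,\overline{\mathrm{tr}}[\Sigma^2(\Sigma+\mu_{\min}I)^{-2}]$, and let $\lambda_{\min}(\phi)=\mu_{\min}-\phi\,\overline{\mathrm{tr}}[\mu_{\min}\Sigma(\Sigma+\mu_{\min}I)^{-1}]$. For $\lambda>\lambda_{\min}(\phi)$, $\mu=\mu(\lambda,\phi)$ is the unique solution with $\mu>\mu_{\min}$ of $\mu=\lambda+\phi\,\overline{\mathrm{tr}}[\mu\Sigma(\Sigma+\mu I)^{-1}]$, and $$\tilde v=\frac{\phi\,\overline{\mathrm{tr}}[\Sigma_0\Sigma(\Sigma+\mu I)^{-2}]}{1-\phi\,\overline{\mathrm{tr}}[\Sigma^2(\Sigma+\mu I)^{-2}]}.$$ The deterministic equivalent of the ridge prediction risk is $\mathscr R(\lambda,\phi)=\mathscr B+\mathscr V+\mathscr S+\kappa^2$ with $\mathscr B=\mu^2\beta^\top(\Sigma+\mu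 I)^{-1}(\tilde v\Sigma+\Sigma_0)(\Sigma+\mu I)^{-1}\beta$, $\mathscr V=\sigma^2\tilde v$, $\mathscr S=2\mu\,\beta^\top(\Sigma+\mu I)^{-1}\Sigma_0(\beta_0-\beta)$, $\kappa^2=(\beta_0-\beta)^\top\Sigma_0(\beta_0-\beta)+\sigma_0^2$. The minimization is over the extended reals (values at $\lambda=\lambda_{\min}(\phi)$ and $\lambda=+\infty$ are understood as limits, possibly $+\infty$); if there are several minimizers, the assertion about $\lambda^*$ holds for any of them.
   Formalization: When σ²=0, part (1) also assumes β≠0 (else the risk is constant and every λ is a minimizer), and part (2) also assumes the strict inequality at v=1/μ(0,φ) (fails as written: Σ=diag(1,10,100), β=(1,0,1), φ=2 gives λ*=0). *)

(* Defs.v *)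
From mathcomp Require Import all_boot all_order all_algebra.
From mathcomp Require Import all_classical all_reals all_analysis.

Set Implicit Arguments.
Unset Strict Implicit.
Unset Printing Implicit Defensive.

Import Order.TTheory GRing.Theory Num.Theory.
Import numFieldNormedType.Exports.

Local Open Scope classical_set_scope.
Local Open Scope ring_scope.

Definition trbar (R : realType) (p : nat) (A : 'M[R]_p.+1) : R :=
  \tr A / p.+1%:R.

Definition bilin (R : realType) (p : nat) (x : 'cV[R]_p.+1)
    (A : 'M[R]_p.+1) (y : 'cV[R]_p.+1) : R :=
  (x^T *m A *m y) 0 0.

(* [a] and [b] are explicit so that the bounds do not depend on the matrix:
   this is "eigenvalues bounded away from 0 and +oo" at a fixed dimension. *)
Definition covariance_in (R : realType) (p : nat) (a b : R)
    (A : 'M[R]_p.+1) : Prop :=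
  A^T = A /\ forall r, eigenvalue A r -> a <= r <= b.

(* [get] picks an element of a set, and is only meaningful when the set is
   nonempty.  When [Sigma] is symmetric positive definite and [0 < phi], each of
   the three sets below (for [ridge_mu]: when [lambda_min Sigma phi < lambda])
   has exactly one element. *)
Definition smallest_eigenvalue (R : realType) (p : nat)
    (A : 'M[R]_p.+1) : R :=
  get [set r | eigenvalue A r /\ forall s, eigenvalue A s -> r <= s].

Definition mu_min (R : realType) (p : nat) (Sigma : 'M[R]_p.+1)
    (phi : R) : R :=
  get [set m | - smallest_eigenvalue Sigma < m /\
               1 = phi * trbar (Sigma ^+ 2 * (Sigma + m%:M) ^- 2)].

Definition lambda_min (R : realType) (p : nat) (Sigma : 'M[R]_p.+1)
    (phi : R) : R :=
  let m := mu_min Sigma phi in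
  m - phi * trbar (m *: (Sigma * (Sigma + m%:M)^-1)).

Definition ridge_mu (R : realType) (p : nat) (Sigma : 'M[R]_p.+1)
    (lambda phi : R) : R :=
  get [set m | mu_min Sigma phi < m /\
               m = lambda + phi * trbar (m *: (Sigma * (Sigma + m%:M)^-1))].

Section Risk.
Variables (R : realType) (p : nat).
Variables (Sigma Sigma0 : 'M[R]_p.+1) (beta beta0 : 'cV[R]_p.+1).
Variables (sigma2 sigma02 : R).   (* the noise variances, already squared *)

Definition vtilde (lambda phi : R) : R :=
  let m := ridge_mu Sigma lambda phi in
  phi * trbar (Sigma0 * Sigma * (Sigma + m%:M) ^- 2) /
  (1 - phi * trbar (Sigma ^+ 2 * (Sigma + m%:M) ^- 2)).

Definition risk_bias (lambda phi : R) : R :=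
  let m := ridge_mu Sigma lambda phi in
  m ^+ 2 * bilin beta ((Sigma + m%:M)^-1 *
                       (vtilde lambda phi *: Sigma + Sigma0) *
                       (Sigma + m%:M)^-1) beta.

Definition risk_variance (lambda phi : R) : R :=
  sigma2 * vtilde lambda phi.

Definition risk_shift (lambda phi : R) : R :=
  let m := ridge_mu Sigma lambda phi in
  2 * m * bilin beta ((Sigma + m%:M)^-1 * Sigma0) (beta0 - beta).

Definition risk_kappa2 : R :=
  bilin (beta0 - beta) Sigma0 (beta0 - beta) + sigma02.

Definition risk (lambda phi : R) : R :=
  risk_bias lambda phi + risk_variance lambda phi + risk_shift lambda phi
  + risk_kappa2.

(* The risk on [[lambda_min, +oo]], with the two end values given by limits in
   the extended reals.  Values below [lambda_min] are junk. *)
Definition ext_risk (phi : R) (lambda : \bar R) : \bar R :=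
  match lambda with
  | l%:E => if l == lambda_min Sigma phi
            then lim ((risk x phi)%:E @[x --> (lambda_min Sigma phi)^'+])
            else (risk l phi)%:E
  | +oo%E => lim ((risk x phi)%:E @[x --> +oo])
  | -oo%E => +oo%E
  end.

End Risk.

Definition is_argmin (R : realType) (D : set (\bar R))
    (f : \bar R -> \bar R) (x : \bar R) : Prop :=
  D x /\ forall y, D y -> (f x <= f y)%E.

Definition alignment (R : realType) (p : nat) (Sigma : 'M[R]_p.+1)
    (beta : 'cV[R]_p.+1) (sigma2 v : R) : Prop :=
  let B := beta *m beta^T in
  (trbar (B * Sigma * (v *: Sigma + 1%:M) ^- 2) + sigma2) /
  (trbar (B * Sigma * (v *: Sigma + 1%:M) ^- 3) + sigma2)
  > trbar (Sigma * (v *: Sigma + 1%:M) ^- 2) /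
    trbar (Sigma * (v *: Sigma + 1%:M) ^- 3).

(* Main.v *)
(** In an eigenbasis of [Sigma], with eigenvalues [s i] and squared coordinates
    [w i] of [beta], the map [m |-> m - phi * tr (m Sigma (Sigma + m)^-1) / N] has
    derivative [1 - T m] with [T m = phi * tr (Sigma^2 (Sigma + m)^-2) / N], so it
    is an increasing bijection from [m > mu_min] to [lambda > lambda_min] and the
    risk may be studied as a function of [m]:
    [(m^2 * sum w s / (s + m)^2 + sigma2 * T m) / (1 - T m)], up to a constant.

    If [phi < 1] then [mu = 0] at [lambda = 0]; for [m < 0] the numerator is larger
    than at [0] and the denominator smaller, and the risk blows up at [mu_min].

    If [phi > 1], put [v = 1 / m] and [q i = 1 / (v * s i + 1)].  The risk becomes
    [(sum w s q^2 + sigma2) / (1 - phi * mean (1 - q)^2)], up to a constant.  The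
    alignment condition together with [lambda >= 0] makes its [v]-derivative
    negative on all of [0 < v <= 1 / mu 0], so that it keeps decreasing slightly
    beyond [1 / mu 0], that is, for some [lambda < 0]. *)

Require Import Defs.
From mathcomp Require Import all_boot all_order all_algebra.
From mathcomp Require Import all_classical all_reals all_analysis.
From mathcomp Require Import spectral sesquilinear complex.
From mathcomp Require Import ring lra.

Set Implicit Arguments.
Unset Strict Implicit.
Unset Printing Implicit Defensive.

Import Order.TTheory GRing.Theory Num.Theory.
Import numFieldNormedType.Exports.

Local Open Scope classical_set_scope.
Local Open Scope ring_scope.

(* [C] is an extension of [R] because the spectral theorem of the library is over
   an algebraically closed field. *)
Definition diagonalized (R : realType) (C : numClosedFieldType)
    (toC : {rmorphism R -> C}) (p : nat) (U : 'M[C]_p.+1)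
    (X : 'M[R]_p.+1) (x : 'I_p.+1 -> R) : Prop :=
  map_mx toC X = invmx U *m diag_mx (\row_i toC (x i)) *m U.

(** * Calculus of matrices that are diagonal in one fixed unitary basis *)

Section Diagonalized.
Variables (R : realType) (C : numClosedFieldType) (toC : {rmorphism R -> C}).
Hypothesis toC_ge0 : forall x, (0 <= toC x) = (0 <= x).
Hypothesis toC_real : forall z, z \is Num.real -> exists x, toC x = z.
Variables (p : nat) (U : 'M[C]_p.+1).
Hypothesis U_unitary : U \is unitarymx.
Implicit Types (X Y : 'M[R]_p.+1) (x y : 'I_p.+1 -> R).

Let U_unit : U \in unitmx. Proof. exact: unitarymx_unit. Qed.

Lemma diagonalizedD X Y x y : diagonalized toC U X x -> diagonalized toC U Y y ->
  diagonalized toC U (X + Y) (fun i => x i + y i).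
Proof.
rewrite /diagonalized map_mxD => -> ->.
rewrite -mulmxDl -mulmxDr -raddfD; congr (_ *m diag_mx _ *m _).
by apply/rowP => i; rewrite !mxE rmorphD.
Qed.

Lemma diagonalizedZ X x (c : R) : diagonalized toC U X x ->
  diagonalized toC U (c *: X) (fun i => c * x i).
Proof.
rewrite /diagonalized map_mxZ => ->.
rewrite scalemxAl scalemxAr -linearZ /=; congr (_ *m diag_mx _ *m _).
by apply/rowP => i; rewrite !mxE rmorphM.
Qed.

Lemma diagonalizedM X Y x y : diagonalized toC U X x -> diagonalized toC U Y y ->
  diagonalized toC U (X * Y) (fun i => x i * y i).
Proof.
rewrite /diagonalized -mulmxE map_mxM => -> ->.
rewrite !mulmxA mulmxK // -[_ *m diag_mx _ *m diag_mx _]mulmxA mulmx_diag.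
congr (_ *m diag_mx _ *m _).
by apply/rowP => i; rewrite !mxE rmorphM.
Qed.

Lemma diagonalized_scalar (c : R) : diagonalized toC U c%:M (fun=> c).
Proof.
rewrite /diagonalized map_scalar_mx.
have -> : \row_i (toC c) = const_mx (toC c) :> 'rV_p.+1 by apply/rowP => i; rewrite !mxE.
by rewrite diag_const_mx -mulmxA mul_scalar_mx -scalemxAr mulVmx // scalemx1.
Qed.

Lemma diagonalizedX X x k : diagonalized toC U X x ->
  diagonalized toC U (X ^+ k) (fun i => x i ^+ k).
Proof.
move=> dX; elim: k => [|k IHk].
  by rewrite expr0; exact: (diagonalized_scalar 1).
rewrite exprS; have := diagonalizedM dX IHk.
by congr (diagonalized _ _); apply/funext => i; rewrite exprS.
Qed.

Lemma diagonalized_det X x : diagonalized toC U X x -> \det X = \prod_i x i.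
Proof.
move=> dX; apply: (fmorph_inj toC).
rewrite /= -det_map_mx dX det_mulmx mulrC -det_mulmx mulmxA mulmxV // mul1mx.
by rewrite det_diag rmorph_prod; apply: eq_bigr => i _; rewrite mxE.
Qed.

Lemma diagonalizedV X x : (forall i, x i != 0) -> diagonalized toC U X x ->
  diagonalized toC U X^-1 (fun i => (x i)^-1).
Proof.
move=> x_neq0 dX.
have X_unit : X \in unitmx.
  rewrite unitmxE (diagonalized_det dX) unitfE prodf_seq_neq0.
  by apply/allP => i _ /=.
set E := invmx U *m diag_mx (\row_i toC ((x i)^-1)) *m U.
have XE : map_mx toC X *m E = 1%:M.
  rewrite dX /E !mulmxA mulmxK // -[_ *m diag_mx _ *m diag_mx _]mulmxA mulmx_diag.
  have -> : \row_i ((\row_i toC (x i)) 0 i * (\row_i toC ((x i)^-1)) 0 i)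
      = const_mx 1 :> 'rV[C]_p.+1.
    by apply/rowP => i; rewrite !mxE -rmorphM divff ?rmorph1.
  by rewrite diag_const_mx mulmx1 mulVmx.
rewrite /diagonalized -[X^-1]/(invmx X) map_invmx.
by rewrite -[LHS]mulmx1 -XE mulmxA mulVmx ?mul1mx // map_unitmx.
Qed.

Lemma diagonalized_trbar X x : diagonalized toC U X x ->
  trbar X = (\sum_i x i) / p.+1%:R.
Proof.
move=> dX; rewrite /trbar; congr (_ / _); apply: (fmorph_inj toC).
rewrite -[LHS]trace_map_mx dX mxtrace_mulC mulmxA mulmxV // mul1mx mxtrace_diag.
by rewrite rmorph_sum /=; apply: eq_bigr => i _; rewrite mxE.
Qed.

Let toC_conj (c : R) : (toC c)^* = toC c.
Proof.
apply: conj_Creal; rewrite realE toC_ge0.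
by rewrite -(opprK (toC c)) -rmorphN oppr_le0 toC_ge0 oppr_ge0 le_total.
Qed.

(** The weights are the squared moduli of the coordinates of [b] in the basis [U]. They depend only
    on [U] and [b], so a single family serves every matrix that is diagonal in that basis. *)
Lemma diagonalized_bilin (b : 'cV[R]_p.+1) : exists w : 'I_p.+1 -> R,
  (forall i, 0 <= w i) /\
  forall X x, diagonalized toC U X x -> bilin b X b = \sum_i w i * x i.
Proof.
pose c := U *m map_mx toC b.
have cP i : `|c i 0| ^+ 2 \is Num.real by apply: ger0_real; rewrite exprn_ge0.
have [w wE] := choice (fun i => toC_real (cP i)).
exists w; split=> [i|X x dX]; first by rewrite -toC_ge0 wE exprn_ge0.
apply: (fmorph_inj toC).
transitivity ((map_mx toC (b^T *m X *m b)) 0 0); first by rewrite mxE.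
rewrite !map_mxM dX invmx_unitary //.
have -> : map_mx toC b^T = (map_mx toC b)^t*%sesqui.
  by apply/matrixP => i j; rewrite !mxE toC_conj.
rewrite !mulmxA -mulmxA -/c.
have -> : ((map_mx toC b)^t* *m U^t*)%sesqui = (c^t*)%sesqui.
  by rewrite -map_mxM -trmx_mul.
rewrite mxE rmorph_sum /=; apply: eq_bigr => i _.
rewrite mul_mx_diag !mxE rmorphM /= wE normCK.
rewrite mulrAC [X in X * toC _]mulrC.
by have -> : c i 0 = \sum_j U i j * map_mx toC b j 0 by rewrite mxE.
Qed.

(** [X - r%:M] is singular exactly when a factor of its determinant, the product of the [x i - r],
    vanishes. *)
Lemma diagonalized_eigenvalue X x r : diagonalized toC U X x ->
  eigenvalue X r <-> exists i, r = x i.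
Proof.
move=> dX.
have dXr : diagonalized toC U (X - r%:M) (fun i => x i - r).
  by rewrite -raddfN; apply: diagonalizedD => //; exact: diagonalized_scalar.
rewrite /eigenvalue /eigenspace kermx_eq0 row_free_unit unitmxE unitfE negbK.
rewrite (diagonalized_det dXr) prodf_seq_eq0; split.
  by move/hasP => [i _]; rewrite /= subr_eq0 => /eqP <-; exists i.
by move=> [i ->]; apply/hasP; exists i; rewrite ?mem_index_enum //= subrr.
Qed.

End Diagonalized.

(** * The spectral theorem for a real symmetric matrix *)

Lemma symmetric_diagonalized (R : realType) (C : numClosedFieldType)
    (toC : {rmorphism R -> C}) (p : nat) (A : 'M[R]_p.+1) :
  (forall x, (0 <= toC x) = (0 <= x)) ->
  (forall z, z \is Num.real -> exists x, toC x = z) ->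
  A^T = A -> exists (U : 'M[C]_p.+1) (s : 'I_p.+1 -> R),
    U \is unitarymx /\ diagonalized toC U A s.
Proof.
move=> toC_ge0 toC_real A_sym; pose AC := map_mx toC A.
have AC_herm : AC \is hermsymmx.
  apply: realsym_hermsym.
    apply/is_hermitianmxP.
    by rewrite expr0 scale1r map_mx_id // /AC map_trmx A_sym.
  apply/mxOverP => i j; rewrite mxE realE toC_ge0.
  by rewrite -(opprK (toC _)) -rmorphN oppr_le0 toC_ge0 oppr_ge0 le_total.
(* The eigenvalues of a Hermitian matrix are real, so they descend from [C] to [R]. *)
have /mxOverP s_real := hermitian_spectral_diag_real AC_herm.
have [s sE] := choice (fun i => toC_real _ (s_real 0 i)).
exists (spectralmx AC), s.
split; first exact: spectral_unitarymx.
rewrite /diagonalized -/AC.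
have /orthomx_spectralP {1}-> := hermitian_normalmx AC_herm.
congr (_ *m diag_mx _ *m _).
by apply/rowP => i; rewrite mxE sE.
Qed.

Lemma numClosed_extension (R : rcfType) :
  exists (C : numClosedFieldType) (toC : {rmorphism R -> C}),
    (forall x, (0 <= toC x) = (0 <= x)) /\
    (forall z, z \is Num.real -> exists x, toC x = z).
Proof.
exists R[i], (real_complex R); split=> [x|z]; first exact: ler0c.
by move=> /complex_realP [x ->]; exists x.
Qed.

(** The field [C] and the basis [U] are hidden behind existentials, so that later statements mention
    only real families. The last clause ranges over all matrices diagonal in the basis because it is
    applied to products of [Sigma] with powers of its resolvents. *)
Definition spectral_data (R : realType) (p : nat) (Sigma : 'M[R]_p.+1)
    (beta : 'cV[R]_p.+1) (s w : 'I_p.+1 -> R) : Prop :=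
  exists (C : numClosedFieldType) (toC : {rmorphism R -> C}) (U : 'M[C]_p.+1),
    [/\ U \is unitarymx, diagonalized toC U Sigma s, forall i, 0 <= w i &
        forall X x, diagonalized toC U X x ->
          bilin beta X beta = \sum_i w i * x i].

Lemma spectral_data_exists (R : realType) (p : nat) (Sigma : 'M[R]_p.+1)
    (beta : 'cV[R]_p.+1) :
  Sigma^T = Sigma -> exists s w, spectral_data Sigma beta s w.
Proof.
move=> Sigma_sym; have [C [toC [toC_ge0 toC_real]]] := numClosed_extension R.
have [U [s [U_unitary dS]]] := symmetric_diagonalized toC_ge0 toC_real Sigma_sym.
have [w [w_ge0 wE]] := diagonalized_bilin toC_ge0 toC_real U_unitary beta.
by exists s, w, C, toC, U.
Qed.

(** * Traces and quadratic forms as sums over the eigenvalues *)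

Section SpectralData.
Variables (R : realType) (p : nat) (Sigma : 'M[R]_p.+1) (beta : 'cV[R]_p.+1).
Variables (s w : 'I_p.+1 -> R).
Hypothesis data : spectral_data Sigma beta s w.

Lemma spectral_data_eigenvalue r : eigenvalue Sigma r <-> exists i, r = s i.
Proof.
have [C [toC [U [U_unitary dS _ _]]]] := data.
exact: (diagonalized_eigenvalue U_unitary _ dS).
Qed.

Lemma spectral_data_weight_ge0 i : 0 <= w i.
Proof. by have [C [toC [U []]]] := data. Qed.

(** Applied to the identity matrix, the quadratic form shows that the weights sum to the squared
    norm of [beta]. *)
Lemma spectral_data_weight_neq0 : beta <> 0 -> exists i, w i != 0.
Proof.
have [C [toC [U [U_unitary _ _ wE]]]] := data.
move=> beta_neq0; apply/existsP; rewrite -negb_forall; apply/negP => /forallP w0.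
apply: beta_neq0; have := wE _ _ (diagonalized_scalar toC U_unitary 1).
rewrite big1 => [|i _]; last by rewrite (eqP (w0 i)) mul0r.
rewrite /bilin mulmx1 mxE => /eqP; rewrite psumr_eq0 => [|i _]; last first.
  by rewrite mxE -expr2 sqr_ge0.
move=> /allP b0; apply/colP => i; rewrite mxE; apply/eqP.
by have := b0 i (mem_index_enum _); rewrite mxE -expr2 sqrf_eq0.
Qed.

Let diagonalized_affine (c m : R) (C : numClosedFieldType) (toC : {rmorphism R -> C})
    (U : 'M[C]_p.+1) :
  U \is unitarymx -> diagonalized toC U Sigma s ->
  diagonalized toC U (c *: Sigma + m%:M) (fun i => c * s i + m).
Proof.
move=> U_unitary dS; apply: diagonalizedD.
  exact: diagonalizedZ.
exact: diagonalized_scalar.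
Qed.

Let diagonalized_resolvent (c m : R) k (C : numClosedFieldType) (toC : {rmorphism R -> C})
    (U : 'M[C]_p.+1) :
  (forall i, c * s i + m != 0) ->
  U \is unitarymx -> diagonalized toC U Sigma s ->
  diagonalized toC U ((c *: Sigma + m%:M) ^- k) (fun i => (c * s i + m) ^- k).
Proof.
move=> sm0 U_unitary dS; apply: (diagonalizedV U_unitary).
  by move=> i; rewrite expf_neq0.
by apply: (diagonalizedX U_unitary); exact: diagonalized_affine.
Qed.

Lemma trbar_gcv (m : R) : (forall i, s i + m != 0) ->
  trbar (Sigma ^+ 2 * (Sigma + m%:M) ^- 2) =
  (\sum_i (s i / (s i + m)) ^+ 2) / p.+1%:R.
Proof.
have [C [toC [U [U_unitary dS _ _]]]] := data; move=> sm0.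
rewrite -[in Sigma + _](scale1r Sigma).
rewrite (diagonalized_trbar U_unitary (diagonalizedM U_unitary
  (diagonalizedX U_unitary 2 dS) (diagonalized_resolvent 2 _ U_unitary dS))).
  by congr (_ / _); apply: eq_bigr => i _; rewrite mul1r expr_div_n.
by move=> i; rewrite mul1r.
Qed.

Lemma trbar_resolvent (m : R) : (forall i, s i + m != 0) ->
  trbar (m *: (Sigma * (Sigma + m%:M)^-1)) =
  (\sum_i m * (s i / (s i + m))) / p.+1%:R.
Proof.
have [C [toC [U [U_unitary dS _ _]]]] := data; move=> sm0.
rewrite -[in Sigma + _](scale1r Sigma) -[_^-1]/((1 *: Sigma + m%:M) ^- 1).
rewrite (diagonalized_trbar U_unitary (diagonalizedZ m (diagonalizedM U_unitary
  dS (diagonalized_resolvent 1 _ U_unitary dS)))).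
  by congr (_ / _); apply: eq_bigr => i _; rewrite mul1r.
by move=> i; rewrite mul1r.
Qed.

Lemma bilin_bias (c m : R) : (forall i, s i + m != 0) ->
  bilin beta ((Sigma + m%:M)^-1 * (c *: Sigma + Sigma) * (Sigma + m%:M)^-1) beta
  = (c + 1) * \sum_i w i * (s i / (s i + m) ^+ 2).
Proof.
have [C [toC [U [U_unitary dS _ wE]]]] := data; move=> sm0.
rewrite -[in Sigma + _](scale1r Sigma) -[_^-1]/((1 *: Sigma + m%:M) ^- 1).
have dR := diagonalized_resolvent 1 _ U_unitary dS.
rewrite (wE _ _ (diagonalizedM U_unitary (diagonalizedM U_unitary (dR _ _ _)
  (diagonalizedD (diagonalizedZ c dS) dS)) (dR _ _ _))).
- rewrite mulr_sumr; apply: eq_bigr => i _.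
  by have := sm0 i => smi; rewrite mul1r expr1; field.
- by move=> i; rewrite mul1r.
- by move=> i; rewrite mul1r.
Qed.

Lemma trbar_power (v : R) k : (forall i, v * s i + 1 != 0) ->
  trbar (Sigma * (v *: Sigma + 1%:M) ^- k) =
  (\sum_i s i / (v * s i + 1) ^+ k) / p.+1%:R.
Proof.
have [C [toC [U [U_unitary dS _ _]]]] := data; move=> sm0.
by rewrite (diagonalized_trbar U_unitary (diagonalizedM U_unitary
  dS (diagonalized_resolvent k sm0 U_unitary dS))).
Qed.

(** By cyclicity, the trace of [beta *m beta^T] times a matrix is the quadratic form of that matrix
    at [beta]. *)
Lemma trbar_signal_power (v : R) k : (forall i, v * s i + 1 != 0) ->
  trbar (beta *m beta^T * Sigma * (v *: Sigma + 1%:M) ^- k) =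
  (\sum_i w i * (s i / (v * s i + 1) ^+ k)) / p.+1%:R.
Proof.
have [C [toC [U [U_unitary dS _ wE]]]] := data; move=> sm0.
rewrite -mulrA -(wE _ _ (diagonalizedM U_unitary
  dS (diagonalized_resolvent k sm0 U_unitary dS))).
rewrite /trbar /bilin; congr (_ / _).
by rewrite -[LHS]/(\tr (beta *m beta^T *m _)) -mulmxA mxtrace_mulC trace_mx11.
Qed.

End SpectralData.

(** * Auxiliary facts on limits, intermediate values and derivatives *)

Lemma cvg_sum_ord (R : realType) (T : Type) (F : set_system T) n
    (f : 'I_n -> T -> R) (l : 'I_n -> R) : Filter F ->
  (forall i, f i x @[x --> F] --> l i) ->
  \sum_i f i x @[x --> F] --> \sum_i l i.
Proof. by move=> FF fl; apply: cvg_big => //; exact: add_continuous. Qed.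

(** Both orders of the end values are allowed, since one application is to a decreasing function and
    the other to an increasing one. *)
Lemma continuous_IVT (R : realType) (f : R -> R) (a b c : R) : a < b ->
  (forall x, a <= x <= b -> {for x, continuous f}) ->
  f a <= c <= f b \/ f b <= c <= f a -> exists2 x, a <= x <= b & f x = c.
Proof.
move=> ab fcont fc; have [] := @IVT R f a b c (ltW ab).
- by apply: continuous_in_subspaceT => x; rewrite inE /= in_itv => /fcont.
- case: fc => /andP[h1 h2]; rewrite ?(min_l (le_trans h1 h2)) ?(max_r (le_trans h1 h2)).
    by rewrite h1.
  by rewrite (min_r (le_trans h1 h2)) (max_l (le_trans h1 h2)) h1.
- by move=> x; rewrite in_itv /= => xab fx; exists x.
Qed.

Lemma is_derive_lt0_right (R : realType) (f : R -> R) (x df : R) :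
  is_derive x 1 f df -> df < 0 ->
  exists2 e, 0 < e & forall h, 0 < h < e -> f (x + h) < f x.
Proof.
move=> dfx df_lt0; have dcvg : derivable f x 1 by exact: ex_derive.
have : h^-1 *: ((f \o shift x) (h *: 1) - f x) @[h --> 0^'] --> df.
  by rewrite -(derive_val (is_derive := dfx)); exact: dcvg.
move=> /cvgr_lt /(_ _ df_lt0) /nbhs_ballP[e /= e_gt0 he].
exists e => // h /andP[h_gt0 he_lt]; have := he h.
rewrite /ball /= sub0r normrN gtr0_norm // => /(_ he_lt (lt0r_neq0 h_gt0)).
rewrite /GRing.scale /= mulr1 pmulr_rlt0 ?invr_gt0 // subr_lt0.
by rewrite addrC.
Qed.

(** * The fixed-point equation between [mu] and [lambda], for given eigenvalues *)

Section FixedPoint.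
Variables (R : realType) (p : nat) (s : 'I_p.+1 -> R) (r phi : R).
Hypothesis s_gt0 : forall i, 0 < s i.
Hypothesis r_le : forall i, r <= s i.
Hypothesis r_min : exists i, r = s i.
Hypothesis phi_gt0 : 0 < phi.

(** The function [T] of the overview. *)
Definition gcv_ratio (m : R) : R :=
  phi * ((\sum_i (s i / (s i + m)) ^+ 2) / p.+1%:R).

(** The fixed-point equation solved for [lambda]; its inverse above [mu_min] is [ridge_mu]. *)
Definition ridge_of_mu (m : R) : R :=
  m - phi * ((\sum_i m * (s i / (s i + m))) / p.+1%:R).

Lemma shifted_gt0 (m : R) : - r < m -> forall i, 0 < s i + m.
Proof. by move=> rm i; have := r_le i; lra. Qed.

Let dim_gt0 : 0 < p.+1%:R :> R. Proof. by rewrite ltr0n. Qed.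

Let ltr_mean (f g : 'I_p.+1 -> R) : (forall i, f i < g i) ->
  (\sum_i f i) / p.+1%:R < (\sum_i g i) / p.+1%:R.
Proof.
move=> fg; rewrite ltr_pM2r ?invr_gt0 //; apply: ltr_sum => //.
by apply/hasP; exists ord0; rewrite ?mem_index_enum.
Qed.

Lemma gcv_ratio_decr (m1 m2 : R) : - r < m1 -> m1 < m2 ->
  gcv_ratio m2 < gcv_ratio m1.
Proof.
move=> rm1 m12; rewrite ltr_pM2l //; apply: ltr_mean => i.
have sm1 := shifted_gt0 rm1 i; have sm2 : 0 < s i + m2 by lra.
rewrite ltr_pXn2r ?nnegrE ?divr_ge0 ?ltW // ?(ltW sm1) //.
by rewrite ltr_pM2l // ltf_pV2 ?posrE // ltrD2l.
Qed.

Lemma gcv_ratio_cont (m : R) : - r < m -> {for m, continuous gcv_ratio}.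
Proof.
move=> rm; apply: cvgM; first exact: cvg_cst.
apply: cvgM; last exact: cvg_cst.
apply: cvg_sum_ord => i; apply: cvgM.
  by apply: cvgM; [exact: cvg_cst|apply: cvgV;
    [rewrite gt_eqF // shifted_gt0|apply: cvgD; [exact: cvg_cst|exact: cvg_id]]].
by apply: cvgM; [exact: cvg_cst|apply: cvgV;
    [rewrite gt_eqF // shifted_gt0|apply: cvgD; [exact: cvg_cst|exact: cvg_id]]].
Qed.

Lemma ridge_of_mu_cont (m : R) : - r < m -> {for m, continuous ridge_of_mu}.
Proof.
move=> rm; apply: cvgB; first exact: cvg_id.
apply: cvgM; first exact: cvg_cst.
apply: cvgM; last exact: cvg_cst.
apply: cvg_sum_ord => i; apply: cvgM; first exact: cvg_id.
by apply: cvgM; [exact: cvg_cst|apply: cvgV;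
    [rewrite gt_eqF // shifted_gt0|apply: cvgD; [exact: cvg_cst|exact: cvg_id]]].
Qed.

(** Intermediate values: near the pole [- r] the term of the smallest eigenvalue alone pushes the
    ratio to at least 1, and far to the right the ratio is at most 1. *)
Lemma gcv_ratio_eq1 : exists2 m : R, - r < m & gcv_ratio m = 1.
Proof.
have [j rj] := r_min; have phi0 := phi_gt0.
have r_gt0 : 0 < r by rewrite rj.
pose N : R := p.+1%:R.
have N_gt0 : 0 < N := dim_gt0.
(* At [m = - r + r * d] the term of the smallest eigenvalue is [d^-1 ^+ 2]. Since [d < 1] and
   [d * N <= phi], also [d ^+ 2 * N <= phi], which is the bound wanted. *)
pose d := phi / (N + phi).
have Np_gt0 : 0 < N + phi by lra.
have d_gt0 : 0 < d by rewrite divr_gt0.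
have d_lt1 : d < 1 by rewrite ltr_pdivrMr // mul1r; lra.
have dN : d * N <= phi.
  by rewrite /d mulrAC ler_pdivrMr // ler_pM2l // lerDl ltW.
have large : 1 <= gcv_ratio (- r + r * d).
  rewrite /gcv_ratio mulrA ler_pdivlMr // mul1r.
  apply: (@le_trans _ _ (phi * (d^-1) ^+ 2)).
    rewrite exprVn ler_pdivlMr ?exprn_gt0 //.
    by rewrite -/N expr2 mulrA; nra.
  rewrite ler_pM2l // (bigD1 j) //= ler_wpDr //.
    by apply: sumr_ge0 => i _; exact: sqr_ge0.
  have -> : s j / (s j + (- r + r * d)) = d^-1.
    by rewrite -rj addrA addrN add0r invfM mulrA divff ?mul1r // gt_eqF.
  by [].
pose S := \sum_i (s i) ^+ 2.
have S_ge0 : 0 <= S by apply: sumr_ge0 => i _; exact: sqr_ge0.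
(* As [M >= 1], the sum of squares at [M] is at most [S / M], and [phi * S <= M] by the choice of
   [M]. *)
pose M := 1 + phi * S.
have M_ge1 : 1 <= M by rewrite lerDl mulr_ge0 // ltW.
have small : gcv_ratio M <= 1.
  rewrite /gcv_ratio mulrA ler_pdivrMr // mul1r.
  apply: (@le_trans _ _ (phi * (S / M))).
    rewrite ler_pM2l // mulr_suml; apply: ler_sum => i _.
    have si := s_gt0 i.
    have sM : M <= s i + M by lra.
    rewrite expr_div_n ler_pM2l ?exprn_gt0 // lef_pV2 ?posrE ?exprn_gt0; try lra.
    by nra.
  have M_gt0 : 0 < M by lra.
  rewrite mulrA ler_pdivrMr //.
  have N1 : 1 <= N by rewrite ler1n.
  by apply: (@le_trans _ _ M); [rewrite /M; lra|nra].
have lt_ends : - r + r * d < M by nra.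
have [||m /andP[m1 m2] Tm] := @continuous_IVT _ gcv_ratio (- r + r * d) M 1 lt_ends.
- move=> m /andP[m1 _]; apply: gcv_ratio_cont.
  by have := mulr_gt0 r_gt0 d_gt0; lra.
- by right; rewrite small large.
- by exists m => //; have := mulr_gt0 r_gt0 d_gt0; lra.
Qed.

(** A finite-difference argument instead of a derivative: the increment of each subtracted term is
    [(m2 - m1) * (s / (s + m1)) * (s / (s + m2))], and replacing [m2] by [m1] in the last factor
    bounds the total strictly by [(m2 - m1) * gcv_ratio m1]. The case [gcv_ratio m1 = 1] is included
    so that [m1] may be [mu_min]. *)
Lemma ridge_of_mu_incr (m1 m2 : R) : - r < m1 -> gcv_ratio m1 <= 1 -> m1 < m2 ->
  ridge_of_mu m1 < ridge_of_mu m2.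
Proof.
move=> rm1 T1 m12.
have : phi * ((\sum_i (m2 * (s i / (s i + m2)) - m1 * (s i / (s i + m1)))) / p.+1%:R)
    < phi * ((\sum_i (m2 - m1) * (s i / (s i + m1)) ^+ 2) / p.+1%:R).
  rewrite ltr_pM2l //; apply: ltr_mean => i.
  have sm1 := shifted_gt0 rm1 i; have sm2 : 0 < s i + m2 by lra.
  have -> : m2 * (s i / (s i + m2)) - m1 * (s i / (s i + m1)) =
      (m2 - m1) * (s i / (s i + m1) * (s i / (s i + m2))).
    by field; rewrite !gt_eqF.
  rewrite ltr_pM2l ?subr_gt0 // expr2 ltr_pM2l ?divr_gt0 //.
  by rewrite ltr_pM2l // ltf_pV2 ?posrE // ltrD2l.
rewrite sumrB mulrBl mulrBr.
have -> : phi * ((\sum_i (m2 - m1) * (s i / (s i + m1)) ^+ 2) / p.+1%:R) =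
    (m2 - m1) * gcv_ratio m1 by rewrite /gcv_ratio -mulr_sumr; ring.
rewrite /ridge_of_mu.
have : (m2 - m1) * gcv_ratio m1 <= m2 - m1.
  by rewrite ger_pMr ?subr_gt0.
set A := phi * _; set B := phi * _; set C := _ * gcv_ratio m1.
move: A B C => A B C; lra.
Qed.

(** Each [m * s / (s + m)] is at most [s], so the map is at least the identity minus a constant, and
    hence unbounded above. *)
Lemma ridge_of_mu_ge (m : R) : 0 <= m ->
  m - phi * ((\sum_i s i) / p.+1%:R) <= ridge_of_mu m.
Proof.
move=> m0; rewrite lerD2l lerN2 ler_pM2l // ler_pM2r ?invr_gt0 //.
apply: ler_sum => i _; have si := s_gt0 i; have sm : 0 < s i + m by lra.
by rewrite mulrA ler_pdivrMr //; nra.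
Qed.

Lemma ridge_of_mu_surj (m1 l : R) : - r < m1 -> gcv_ratio m1 <= 1 ->
  ridge_of_mu m1 < l -> exists2 m : R, m1 < m & ridge_of_mu m = l.
Proof.
move=> rm1 T1 m1l.
have := ridge_of_mu_ge; have : 0 <= phi * ((\sum_i s i) / p.+1%:R).
  apply: mulr_ge0; first exact: ltW.
  by apply: divr_ge0; [apply: sumr_ge0 => i _; exact: ltW|exact: ltW].
move: (phi * _) => K K_ge0 ridge_ge.
(* Large enough that [m1 < M] and that the lower bound [M - K] is at least [l]. *)
pose M := 1 + `|m1| + `|l| + K.
have := ler_norm m1; have := ler_norm l.
have := normr_ge0 m1; have := normr_ge0 l => l0 m10 ll m1m.
have M_ge0 : 0 <= M by rewrite /M; lra.
have m1M : m1 < M by rewrite /M; lra.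
have lM : l <= ridge_of_mu M.
  by apply: le_trans (ridge_ge M M_ge0); rewrite /M; lra.
have [||m /andP[h1 h2] fm] := @continuous_IVT _ ridge_of_mu m1 M l m1M.
- by move=> m /andP[h1 _]; apply: ridge_of_mu_cont; lra.
- by left; rewrite lM (ltW m1l).
- exists m => //; rewrite lt_neqAle h1 andbT; apply/eqP => E.
  by move: m1l; rewrite E fm ltxx.
Qed.

End FixedPoint.

(** * The chosen solutions [mu_min] and [ridge_mu], and the risk as a function of [mu] *)

Section RidgeMu.
Variables (R : realType) (p : nat) (Sigma : 'M[R]_p.+1) (beta : 'cV[R]_p.+1).
Variables (s w : 'I_p.+1 -> R) (phi : R).
Hypothesis data : spectral_data Sigma beta s w.
Hypothesis s_gt0 : forall i, 0 < s i.
Hypothesis phi_gt0 : 0 < phi.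

Let r := smallest_eigenvalue Sigma.
Let m0 := mu_min Sigma phi.

Let r_eigen : eigenvalue Sigma r /\ forall t, eigenvalue Sigma t -> r <= t.
Proof.
apply: (@getPex _ [set t | eigenvalue Sigma t /\
  forall u, eigenvalue Sigma u -> t <= u]).
exists (s [arg min_(i < ord0) s i]%O) => /=; split.
  by apply/(spectral_data_eigenvalue data); eexists.
move=> u /(spectral_data_eigenvalue data) [j ->].
by case: arg_minP => // i _; apply.
Qed.

Let r_le i : r <= s i.
Proof. by apply: r_eigen.2; apply/(spectral_data_eigenvalue data); exists i. Qed.

Let r_min : exists i, r = s i.
Proof. by apply/(spectral_data_eigenvalue data); exact: r_eigen.1. Qed.

Let shifted_neq0 m : - r < m -> forall i, s i + m != 0.
Proof. by move=> rm i; rewrite gt_eqF // (shifted_gt0 r_le). Qed.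

Lemma mu_minP : - smallest_eigenvalue Sigma < mu_min Sigma phi /\
  gcv_ratio s phi (mu_min Sigma phi) = 1.
Proof.
have [] : [set m | - r < m /\
    1 = phi * trbar (Sigma ^+ 2 * (Sigma + m%:M) ^- 2)] m0.
  apply: getPex; have [m rm Tm] := gcv_ratio_eq1 s_gt0 r_le r_min phi_gt0.
  by exists m; split=> //; rewrite (trbar_gcv data (shifted_neq0 rm)); exact: esym.
by move=> rm Tm; split=> //; rewrite [RHS]Tm (trbar_gcv data (shifted_neq0 rm)).
Qed.

Let rm0 : - r < m0. Proof. exact: mu_minP.1. Qed.
Let Tm0 : gcv_ratio s phi m0 = 1. Proof. exact: mu_minP.2. Qed.

Lemma mu_min_shifted_gt0 m : mu_min Sigma phi <= m -> forall i, 0 < s i + m.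
Proof. by move=> m0m i; rewrite (shifted_gt0 r_le) // (lt_le_trans rm0). Qed.

Lemma mu_min_gcv_ratio_cont :
  {for mu_min Sigma phi, continuous (gcv_ratio s phi)}.
Proof. exact: (gcv_ratio_cont r_le rm0). Qed.

Lemma mu_min_gcv_ratio_decr (m1 m2 : R) : mu_min Sigma phi <= m1 -> m1 < m2 ->
  gcv_ratio s phi m2 < gcv_ratio s phi m1.
Proof.
move=> m01 m12; apply: (gcv_ratio_decr s_gt0 r_le phi_gt0) => //.
exact: lt_le_trans m01.
Qed.

Lemma mu_min_gcv_ratio_lt1 m : mu_min Sigma phi < m -> gcv_ratio s phi m < 1.
Proof. by move=> m0m; rewrite -Tm0 mu_min_gcv_ratio_decr. Qed.

Lemma gcv_ratio0 : gcv_ratio s phi 0 = phi.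
Proof.
rewrite /gcv_ratio (eq_bigr (fun=> 1)) => [|i _]; last first.
  by rewrite addr0 divff ?expr1n // gt_eqF.
by rewrite sumr_const card_ord divff ?mulr1 // pnatr_eq0.
Qed.

(** The ratio is strictly decreasing, equal to [phi] at 0 and to 1 at [mu_min]; comparing the two
    values locates [mu_min] with respect to 0. *)
Lemma mu_min_lt0 : phi < 1 -> mu_min Sigma phi < 0.
Proof.
move=> phi_lt1; have r_gt0 : - r < 0 by have [i ->] := r_min; rewrite oppr_lt0.
case: (ltgtP (mu_min Sigma phi) 0) => // [m0_gt0|m0_eq0].
  have := gcv_ratio_decr s_gt0 r_le phi_gt0 r_gt0 m0_gt0.
  by rewrite mu_minP.2 gcv_ratio0 ltNge ltW.
by move: Tm0 phi_lt1; rewrite /m0 m0_eq0 gcv_ratio0 => ->; rewrite ltxx.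
Qed.

Lemma mu_min_gt0 : 1 < phi -> 0 < mu_min Sigma phi.
Proof.
move=> phi_gt1; case: (ltgtP (mu_min Sigma phi) 0) => // [m0_lt0|m0_eq0].
  by have := mu_min_gcv_ratio_lt1 m0_lt0; rewrite gcv_ratio0 ltNge ltW.
by move: Tm0 phi_gt1; rewrite /m0 m0_eq0 gcv_ratio0 => ->; rewrite ltxx.
Qed.

Lemma lambda_minE : lambda_min Sigma phi = ridge_of_mu s phi (mu_min Sigma phi).
Proof. by rewrite /lambda_min (trbar_resolvent data (shifted_neq0 rm0)). Qed.

Lemma ridge_of_mu_lt (m1 m2 : R) : mu_min Sigma phi <= m1 -> m1 < m2 ->
  ridge_of_mu s phi m1 < ridge_of_mu s phi m2.
Proof.
move=> m01 m12; have rm1 : - r < m1 by exact: lt_le_trans m01.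
apply: (ridge_of_mu_incr s_gt0 r_le phi_gt0) => //.
by case: (ltgtP m0 m1) m01 => // [/mu_min_gcv_ratio_lt1/ltW //|<-]; rewrite Tm0.
Qed.

Lemma ridge_of_mu_inj (m1 m2 : R) : mu_min Sigma phi <= m1 ->
  mu_min Sigma phi <= m2 -> ridge_of_mu s phi m1 = ridge_of_mu s phi m2 ->
  m1 = m2.
Proof.
move=> m01 m02 E; case: (ltgtP m1 m2) => // m12.
  by have := ridge_of_mu_lt m01 m12; rewrite E ltxx.
by have := ridge_of_mu_lt m02 m12; rewrite E ltxx.
Qed.

Lemma ridge_muP l : lambda_min Sigma phi < l ->
  mu_min Sigma phi < ridge_mu Sigma l phi /\
  ridge_of_mu s phi (ridge_mu Sigma l phi) = l.
Proof.
rewrite lambda_minE => ml.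
have [] : [set m | m0 < m /\
    m = l + phi * trbar (m *: (Sigma * (Sigma + m%:M)^-1))] (ridge_mu Sigma l phi).
  apply: getPex.
  have [|m m0m lm] := ridge_of_mu_surj s_gt0 r_le phi_gt0 rm0 _ ml.
    by rewrite Tm0.
  exists m; split=> //; rewrite (trbar_resolvent data) -?lm ?subrK //.
  by apply: shifted_neq0; exact: lt_trans m0m.
move=> m0m mE; split=> //.
apply/eqP; rewrite subr_eq {1}mE (trbar_resolvent data) //.
by apply: shifted_neq0; exact: lt_trans m0m.
Qed.

(** [ridge_mu] picks some solution; injectivity of [ridge_of_mu] forces it to be [m]. *)
Lemma ridge_of_muK (m : R) : mu_min Sigma phi < m ->
  lambda_min Sigma phi < ridge_of_mu s phi m /\
  ridge_mu Sigma (ridge_of_mu s phi m) phi = m.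
Proof.
move=> m0m; have lm : lambda_min Sigma phi < ridge_of_mu s phi m.
  by rewrite lambda_minE ridge_of_mu_lt.
have [m0m' mE] := ridge_muP lm.
by split=> //; apply: ridge_of_mu_inj => //; exact: ltW.
Qed.

Lemma ridge_mu_lt (l1 l2 : R) : lambda_min Sigma phi < l1 -> l1 < l2 ->
  ridge_mu Sigma l1 phi < ridge_mu Sigma l2 phi.
Proof.
move=> l1P l12; have [m01 E1] := ridge_muP l1P.
have [m02 E2] := ridge_muP (lt_trans l1P l12).
rewrite ltNge; apply/negP; rewrite le_eqVlt => /predU1P[E|h].
  by move: l12; rewrite -E1 -E2 E ltxx.
by have := ridge_of_mu_lt (ltW m02) h; rewrite E1 E2 ltNge ltW.
Qed.

Definition risk_of_mu (sigma2 m : R) : R :=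
  (m ^+ 2 * (\sum_i w i * (s i / (s i + m) ^+ 2)) +
   sigma2 * gcv_ratio s phi m) / (1 - gcv_ratio s phi m).

(** With equal train and test distributions, [vtilde] is [T / (1 - T)], hence [vtilde + 1] is
    [1 / (1 - T)]; the shift term and the quadratic part of [risk_kappa2] vanish. *)
Lemma riskE (sigma2 sigma02 l : R) : lambda_min Sigma phi < l ->
  risk Sigma Sigma beta beta sigma2 sigma02 l phi =
  risk_of_mu sigma2 (ridge_mu Sigma l phi) + sigma02.
Proof.
move=> /ridge_muP[m0m _].
have vE : vtilde Sigma Sigma l phi = gcv_ratio s phi (ridge_mu Sigma l phi) /
    (1 - gcv_ratio s phi (ridge_mu Sigma l phi)).
  rewrite /vtilde /= -expr2 (trbar_gcv data) //.
  by apply: shifted_neq0; exact: lt_trans m0m.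
have bilin0 x X : bilin x X (beta - beta) = 0.
  by rewrite /bilin subrr mulmx0 mxE.
rewrite /risk /risk_bias /risk_variance /risk_shift /risk_kappa2 vE !bilin0.
rewrite mulr0 addr0 add0r; congr (_ + _).
rewrite (bilin_bias data) /risk_of_mu; last first.
  by apply: shifted_neq0; exact: lt_trans m0m.
have T1 := mu_min_gcv_ratio_lt1 m0m; set S := \sum_i _.
by move: (gcv_ratio _ _ _) S T1 => T S T1; field; rewrite gt_eqF // subr_gt0.
Qed.

End RidgeMu.

(** * Monotonicity of the risk in the variable [v = 1 / mu] *)

Section InverseRidge.
Variables (R : realType) (p : nat) (s w : 'I_p.+1 -> R) (phi sigma2 : R).
Hypothesis s_gt0 : forall i, 0 < s i.
Hypothesis w_ge0 : forall i, 0 <= w i.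
Hypothesis phi_gt0 : 0 < phi.
Hypothesis sigma2_ge0 : 0 <= sigma2.

Definition shrink (v : R) (i : 'I_p.+1) : R := (v * s i + 1)^-1.

Definition shrink_mean (k : nat) (v : R) : R :=
  (\sum_i s i * shrink v i ^+ k) / p.+1%:R.

Definition shrink_signal (k : nat) (v : R) : R :=
  \sum_i w i * (s i * shrink v i ^+ k).

(** For [m > 0] this is [1 - gcv_ratio m] at [v = 1 / m]. It also makes sense at [v = 0], which
    stands for [lambda = +oo]. *)
Definition shrink_denom (v : R) : R :=
  1 - phi * ((\sum_i (1 - shrink v i) ^+ 2) / p.+1%:R).

(** Adding [sigma2] to the risk turns the term [sigma2 * T] of the numerator into the constant
    [sigma2]. *)
Definition inv_risk (v : R) : R :=
  (shrink_signal 2 v + sigma2) / shrink_denom v.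

Let shift_gt0 (v : R) i : 0 <= v -> 0 < v * s i + 1.
Proof. by move=> v0; have := mulr_ge0 v0 (ltW (s_gt0 i)); lra. Qed.

Let shrink_gt0 (v : R) i : 0 <= v -> 0 < shrink v i.
Proof. by move=> v0; rewrite invr_gt0 shift_gt0. Qed.

Let s_ge0 i : 0 <= s i. Proof. exact: ltW. Qed.

Let shrink_ge0 (v : R) i : 0 <= v -> 0 <= shrink v i.
Proof. by move=> v0; rewrite ltW ?shrink_gt0. Qed.

Let shrink_lt1 (v : R) i : 0 < v -> shrink v i < 1.
Proof.
move=> v0; rewrite invf_lt1 ?shift_gt0 ?ltW //.
by have := mulr_gt0 v0 (s_gt0 i); lra.
Qed.

Let shrinkN (v : R) i : 0 <= v -> 1 - shrink v i = v * s i * shrink v i.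
Proof.
move=> v0; have := shift_gt0 i v0; rewrite /shrink => vs.
by field; rewrite gt_eqF.
Qed.

(** With [q = shrink v i], one factor of [(1 - q) ^+ 2] is rewritten as [v * s i * q]. *)
Lemma shrink_denomE (v : R) : 0 <= v ->
  shrink_denom v = 1 - v * phi * shrink_mean 1 v + v * phi * shrink_mean 2 v.
Proof.
move=> v0; rewrite /shrink_denom /shrink_mean.
have -> : \sum_i (1 - shrink v i) ^+ 2 =
    v * (\sum_i s i * shrink v i ^+ 1 - \sum_i s i * shrink v i ^+ 2).
  rewrite -sumrB mulr_sumr; apply: eq_bigr => i _.
  by rewrite expr2 [in X in X * _]shrinkN //; ring.
by ring.
Qed.

Lemma shrink_mean_decr k (v : R) : 0 < v ->
  shrink_mean k.+1 v < shrink_mean k v.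
Proof.
move=> v0; rewrite ltr_pM2r ?invr_gt0 ?ltr0n //; apply: ltr_sum => [|i _].
  by apply/hasP; exists ord0; rewrite ?mem_index_enum.
by rewrite ltr_pM2l // exprS gtr_pMl ?exprn_gt0 ?shrink_lt1 ?shrink_gt0 ?(ltW v0).
Qed.

Lemma shrink_mean_gt0 k (v : R) : 0 <= v -> 0 < shrink_mean k v.
Proof.
move=> v0; rewrite divr_gt0 ?ltr0n // (bigD1 ord0) //= ltr_wpDr //.
  by apply: sumr_ge0 => i _; rewrite mulr_ge0 ?exprn_ge0 ?shrink_ge0.
by rewrite mulr_gt0 ?exprn_gt0 ?shrink_gt0.
Qed.

Lemma shrink_signal_ge0 k (v : R) : 0 <= v -> 0 <= shrink_signal k v.
Proof.
move=> v0; apply: sumr_ge0 => i _.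
by rewrite !mulr_ge0 ?exprn_ge0 ?shrink_ge0.
Qed.

Lemma shrink_signal_noninc k (v : R) : 0 < v ->
  shrink_signal k.+1 v <= shrink_signal k v.
Proof.
move=> v0; apply: ler_sum => i _; rewrite ler_wpM2l // ler_pM2l // exprS.
by rewrite ger_pMl ?exprn_gt0 ?shrink_gt0 ?(ltW v0) // (ltW (shrink_lt1 _ _)).
Qed.

Let is_derive_sum_ord (f : 'I_p.+1 -> R -> R) (df : 'I_p.+1 -> R) (v : R) :
  (forall i, is_derive v 1 (f i) (df i)) ->
  is_derive v 1 (fun x => \sum_i f i x) (\sum_i df i).
Proof.
move=> dfi; have := is_derive_sum dfi.
by congr (is_derive _ _ _ _); apply/funext => x; rewrite fct_sumE.
Qed.

Let is_derive_shrink (v : R) i : 0 <= v ->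
  is_derive v 1 (shrink^~ i) (- s i * shrink v i ^+ 2).
Proof.
move=> v0; have vs := shift_gt0 i v0.
have vs0 : v * s i + 1 != 0 by rewrite gt_eqF.
have dl : is_derive v 1 (fun x : R => x * s i + 1) (s i).
  apply: is_derive_eq; rewrite scaler0 add0r addr0 /GRing.scale /= mulr1.
  by [].
apply: (is_derive_eq (@is_deriveV _ (fun x => x * s i + 1) _ _ _ vs0 dl)).
by rewrite /shrink /GRing.scale /= exprVn !mulNr mulrC.
Qed.

(** Since [q' = - s * q ^+ 2] and [s * q = (1 - q) / v], the derivative of [q ^+ 2] is
    [- 2 * (q ^+ 2 - q ^+ 3) / v], which involves only signals already in use. *)
Lemma is_derive_shrink_signal (v : R) : 0 < v ->
  is_derive v 1 (shrink_signal 2)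
    (- 2 * (shrink_signal 2 v - shrink_signal 3 v) / v).
Proof.
move=> v0; have d i := is_derive_shrink i (ltW v0).
apply: (@is_derive_eq _ _ _ _ _ _ _
  (\sum_i w i * (s i * (2 * shrink v i * (- s i * shrink v i ^+ 2))))).
  apply: is_derive_sum_ord => i; apply: is_derive_eq.
  by rewrite /GRing.scale /=; ring.
apply: (mulIf (lt0r_neq0 v0)); rewrite divfK ?gt_eqF //.
rewrite /shrink_signal -sumrB mulr_suml mulr_sumr; apply: eq_bigr => i _.
have := shrinkN i (ltW v0); set q := shrink v i => qE.
have -> : w i * (s i * q ^+ 2) - w i * (s i * q ^+ 3) =
   w i * s i * q ^+ 2 * (1 - q) by ring.
by rewrite qE; ring.
Qed.

Lemma is_derive_shrink_denom (v : R) : 0 <= v ->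
  is_derive v 1 shrink_denom (- 2 * phi * (shrink_mean 2 v - shrink_mean 3 v)).
Proof.
move=> v0; have d i := is_derive_shrink i v0.
have dS : is_derive v 1 (fun x => \sum_i (1 - shrink x i) ^+ 2)
    (\sum_i (2 * (s i * shrink v i ^+ 2 - s i * shrink v i ^+ 3))).
  apply: is_derive_sum_ord => i; apply: is_derive_eq.
  by rewrite /GRing.scale /=; ring.
apply: is_derive_eq.
rewrite /GRing.scale /= /shrink_mean -mulr_sumr sumrB.
ring.
Qed.

Let shrink_cont (v : R) i : 0 <= v -> {for v, continuous (shrink^~ i)}.
Proof.
move=> v0; have d := is_derive_shrink i v0.
by apply/differentiable_continuous/derivable1_diffP; exact: ex_derive.
Qed.

Lemma shrink_mean_cont k (v : R) : 0 <= v -> {for v, continuous (shrink_mean k)}.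
Proof.
move=> v0; apply: cvgM; last exact: cvg_cst.
apply: cvg_sum_ord => i; apply: cvgM; first exact: cvg_cst.
exact: cvg_comp _ _ (shrink_cont v0) (@exprn_continuous R k _).
Qed.

Lemma shrink_signal_cont k (v : R) : 0 <= v ->
  {for v, continuous (shrink_signal k)}.
Proof.
move=> v0; apply: cvg_sum_ord => i; apply: cvgM; first exact: cvg_cst.
apply: cvgM; first exact: cvg_cst.
exact: cvg_comp _ _ (shrink_cont v0) (@exprn_continuous R k _).
Qed.

Lemma inv_risk_cont (v : R) : 0 <= v -> shrink_denom v != 0 ->
  {for v, continuous inv_risk}.
Proof.
move=> v0 D0; apply: cvgM.
  by apply: cvgD; [exact: shrink_signal_cont|exact: cvg_cst].
apply: cvgV => //; have d := is_derive_shrink_denom v0.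
by apply/differentiable_continuous/derivable1_diffP; exact: ex_derive.
Qed.

(* With [D = shrink_denom v], the condition on [shrink_mean 1] gives
   [D >= v * phi * shrink_mean 2 v]. *)
Lemma inv_risk_derive_lt0 (v : R) : 0 < v -> 0 < shrink_denom v ->
  v * phi * shrink_mean 1 v <= 1 ->
  (shrink_signal 3 v + sigma2) * shrink_mean 2 v <
  (shrink_signal 2 v + sigma2) * shrink_mean 3 v ->
  exists2 df, is_derive v 1 inv_risk df & df < 0.
Proof.
move=> v0 D_gt0 le1 gap.
have dP := is_derive_shrink_signal v0.
have dD := is_derive_shrink_denom (ltW v0).
have D_neq0 : shrink_denom v != 0 by rewrite gt_eqF.
have dV := is_deriveV D_neq0 dD.
eexists.
  exact: (is_deriveM (is_deriveD dP (is_derive_cst sigma2 v 1)) dV).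
rewrite /GRing.scale /= -[(_ + cst _) v]/(shrink_signal 2 v + sigma2).
have A23 := shrink_signal_noninc 2 v0.
have A2_ge0 := shrink_signal_ge0 2 (ltW v0).
have t23 := shrink_mean_decr 2 v0.
have t2_gt0 := shrink_mean_gt0 2 (ltW v0).
have DE := shrink_denomE (ltW v0).
have phi0 := phi_gt0; have sig0 := sigma2_ge0.
move: (shrink_signal 2 v) (shrink_signal 3 v) (shrink_mean 1 v)
  (shrink_mean 2 v) (shrink_mean 3 v) (shrink_denom v) D_gt0 le1 gap D_neq0 A23
  A2_ge0 t23 t2_gt0 DE.
move=> A2 A3 t1 t2 t3 D D_gt0 le1 gap D_neq0 A23 A2_ge0 t23 t2_gt0 DE.
(* The difference of the two sides is the derivative up to the positive factor [2 / (v * D ^+ 2)].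
   Both sides are compared with [v * phi * t2 * (A2 - A3)]: [h2] is [gap] rearranged, and [h1] comes
   from [le1]. *)
have step : v * phi * (t2 - t3) * (A2 + sigma2) < D * (A2 - A3).
  have h1 : v * phi * t2 <= D by rewrite DE; lra.
  have h2 : (t2 - t3) * (A2 + sigma2) < t2 * (A2 - A3) by lra.
  have vphi : 0 < v * phi by rewrite mulr_gt0.
  apply: (@lt_le_trans _ _ (v * phi * t2 * (A2 - A3))).
    by rewrite -!mulrA ltr_pM2l // ltr_pM2l.
  by rewrite ler_wpM2r // subr_ge0.
set X := (X in X < 0).
have -> : X = 2 * (v * phi * (t2 - t3) * (A2 + sigma2) - D * (A2 - A3)) /
    (v * D ^+ 2).
  by rewrite /X; field; rewrite D_neq0 gt_eqF.
rewrite pmulr_llt0 ?invr_gt0 ?mulr_gt0 ?exprn_gt0 //.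
by rewrite pmulr_rlt0 ?subr_lt0.
Qed.

Definition aligned (v : R) : Prop :=
  shrink_mean 2 v / shrink_mean 3 v <
  (shrink_signal 2 v / p.+1%:R + sigma2) /
  (shrink_signal 3 v / p.+1%:R + sigma2).

(* The traces in [aligned] carry a factor 1 / (p + 1) that the bias term of the
   risk does not, hence [p.+1] here against no factor in [aligned_signal_lt]. *)
Definition alignment_gap (v : R) : R :=
  shrink_signal 2 v * shrink_mean 3 v - shrink_signal 3 v * shrink_mean 2 v -
  p.+1%:R * sigma2 * (shrink_mean 2 v - shrink_mean 3 v).

Lemma aligned_gap_gt0 (v : R) : 0 < v -> aligned v -> 0 < alignment_gap v.
Proof.
move=> v0; rewrite /aligned /alignment_gap.
have N_gt0 : 0 < p.+1%:R :> R by rewrite ltr0n.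
have t2 := shrink_mean_gt0 2 (ltW v0); have t3 := shrink_mean_gt0 3 (ltW v0).
have A3 := shrink_signal_ge0 3 (ltW v0).
have sig0 := sigma2_ge0.
move: (p.+1%:R : R) (shrink_signal 2 v) (shrink_signal 3 v) (shrink_mean 2 v)
  (shrink_mean 3 v) N_gt0 t2 t3 A3 => N A2 A3 t2 t3 N_gt0 t2_gt0 t3_gt0 A3_ge0.
have den_ge0 : 0 <= A3 / N + sigma2 by rewrite addr_ge0 // divr_ge0 // ltW.
case: (ltgtP (A3 / N + sigma2) 0) => [|den_gt0|->]; first by rewrite ltNge den_ge0.
  rewrite ltr_pdivrMr // mulrAC ltr_pdivlMr // => h.
  have := h; rewrite -(ltr_pM2l N_gt0).
  have -> : N * (t2 * (A3 / N + sigma2)) = t2 * (A3 + N * sigma2).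
    by field; rewrite gt_eqF.
  have -> : N * ((A2 / N + sigma2) * t3) = (A2 + N * sigma2) * t3.
    by field; rewrite gt_eqF.
  lra.
(* A zero denominator makes the quotient 0 by convention, which cannot exceed a quotient of positive
   numbers. *)
by rewrite invr0 mulr0 ltNge divr_ge0 // ltW.
Qed.

(** The risk involves [sigma2] once where the alignment gap has it [p.+1] times; the surplus of [p]
    copies is a nonnegative reserve. *)
Lemma alignment_gapE (v : R) :
  (shrink_signal 2 v + sigma2) * shrink_mean 3 v -
  (shrink_signal 3 v + sigma2) * shrink_mean 2 v =
  alignment_gap v + p%:R * sigma2 * (shrink_mean 2 v - shrink_mean 3 v).
Proof. by rewrite /alignment_gap -natr1; ring. Qed.

Lemma aligned_signal_lt (v : R) : 0 < v -> aligned v ->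
  (shrink_signal 3 v + sigma2) * shrink_mean 2 v <
  (shrink_signal 2 v + sigma2) * shrink_mean 3 v.
Proof.
move=> v0 /(aligned_gap_gt0 v0) gap; rewrite -subr_gt0 alignment_gapE.
by rewrite ltr_wpDr // !mulr_ge0 // subr_ge0 ltW // shrink_mean_decr.
Qed.

Lemma alignment_gap_cont (v : R) : 0 <= v -> {for v, continuous alignment_gap}.
Proof.
move=> v0; apply: cvgB.
  by apply: cvgB; apply: cvgM;
    (exact: shrink_signal_cont || exact: shrink_mean_cont).
apply: cvgM; first exact: cvg_cst.
by apply: cvgB; exact: shrink_mean_cont.
Qed.

(* When [0 < sigma2], only [0 <= alignment_gap v0] survives in the limit; the
   missing strictness comes from the factor [p.+1] in [alignment_gap], except in
   dimension one, where alignment never holds. *)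
Lemma aligned_limit_signal_lt (v0 : R) : 0 < v0 ->
  (forall v, 0 < v < v0 -> aligned v) -> (sigma2 = 0 -> aligned v0) ->
  (shrink_signal 3 v0 + sigma2) * shrink_mean 2 v0 <
  (shrink_signal 2 v0 + sigma2) * shrink_mean 3 v0.
Proof.
move=> v0_gt0 aligned_lt aligned_v0.
have [/esym/aligned_v0|sig_neq0] := eqVneq 0 sigma2.
  exact: aligned_signal_lt.
have sig_gt0 : 0 < sigma2 by rewrite lt_def eq_sym sig_neq0 sigma2_ge0.
have p_neq0 : (0 < p)%N.
  (* In dimension one the signal terms of the gap cancel and leave [- sigma2 * (shrink_mean 2 v -
     shrink_mean 3 v) < 0], against alignment at [v0 / 2]. *)
  rewrite lt0n; apply/eqP => p0.
  have half : 0 < v0 / 2 < v0 by lra.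
  have [half_gt0 _] := andP half.
  have := aligned_gap_gt0 half_gt0 (aligned_lt _ half).
  have := shrink_mean_decr 2 half_gt0.
  have sum1 (f : 'I_p.+1 -> R) : \sum_i f i = f ord0.
    rewrite (bigD1 ord0) //= big1 ?addr0 // => i /eqP; case.
    apply: val_inj; apply/eqP; rewrite /= -leqn0 -[X in (_ <= X)%N]p0 -ltnS.
    exact: ltn_ord.
  have p1 : p.+1%:R = 1 :> R by rewrite p0.
  rewrite /alignment_gap /shrink_signal /shrink_mean !sum1 p1 !divr1 => lt32.
  set q := shrink _ _ in lt32 *.
  have -> : w ord0 * (s ord0 * q ^+ 2) * (s ord0 * q ^+ 3) -
      w ord0 * (s ord0 * q ^+ 3) * (s ord0 * q ^+ 2) = 0 by ring.
  by rewrite add0r oppr_gt0 mul1r pmulr_rlt0 // subr_lt0 ltNge ltW.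
have gap_ge0 : 0 <= alignment_gap v0.
  rewrite leNgt; apply/negP => gap_lt0.
  have /cvg_at_left_filter gapL := alignment_gap_cont (ltW v0_gt0).
  suff : \forall v \near v0^'-, False by move/filter_ex => [].
  near=> v.
  have : 0 < alignment_gap v.
    have v_gt0 : 0 < v by near: v; exact: nbhs_left_gt.
    apply: aligned_gap_gt0 => //; apply: aligned_lt; rewrite v_gt0.
    by near: v; exact: nbhs_left_lt.
  apply/negP; rewrite -leNgt ltW //.
  by near: v; exact: (cvgr_lt _ gapL).
rewrite -subr_gt0 alignment_gapE ltr_wpDl // !mulr_gt0 ?ltr0n //.
by rewrite subr_gt0 shrink_mean_decr.
Unshelve. all: by end_near. Qed.

Variable v0 : R.
Hypothesis v0_gt0 : 0 < v0.
Hypothesis denom_gt0 : forall v, 0 <= v <= v0 -> 0 < shrink_denom v.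
Hypothesis mean_le1 : forall v, 0 < v <= v0 -> v * phi * shrink_mean 1 v <= 1.
Hypothesis aligned_lt : forall v, 0 < v < v0 -> aligned v.
Hypothesis aligned_v0 : sigma2 = 0 -> aligned v0.

Let derive_lt0 v : 0 < v <= v0 ->
  exists2 df, is_derive v 1 inv_risk df & df < 0.
Proof.
move=> vP; have /andP[v_gt0 vv0] := vP.
apply: inv_risk_derive_lt0 => //; last 1 first.
- case: (ltgtP v v0) vv0 => // [vlt|->] _.
    by apply: aligned_signal_lt => //; apply: aligned_lt; rewrite v_gt0.
  exact: aligned_limit_signal_lt.
- by apply: denom_gt0; rewrite ltW.
- exact: mean_le1.
Qed.

(** The derivative is used on the open interval only; continuity brings in [u = 0], that is,
    [lambda = +oo]. *)
Lemma inv_risk_decr (u v : R) : 0 <= u -> u < v -> v <= v0 ->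
  inv_risk v < inv_risk u.
Proof.
apply: (@ltr0_derive1_decr _ _ 0 v0).
- by move=> x; rewrite in_itv /= => /andP[x0 xv];
    have [|df dfx _] := @derive_lt0 x; [rewrite x0 ltW|exact: ex_derive].
- move=> x; rewrite in_itv /= => /andP[x0 xv].
  have [|df dfx] := @derive_lt0 x; first by rewrite x0 ltW.
  by rewrite derive1E derive_val.
- apply: continuous_in_subspaceT => x; rewrite inE /= in_itv /= => xP.
  have /andP[x0 xv] := xP.
  by apply: inv_risk_cont => //; rewrite gt_eqF // denom_gt0.
Qed.

Lemma inv_risk_decr_right : exists2 e, 0 < e &
  forall h, 0 < h < e -> inv_risk (v0 + h) < inv_risk v0.
Proof.
have [|df dfx df_lt0] := @derive_lt0 v0; first by rewrite v0_gt0 lexx.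
exact: is_derive_lt0_right dfx df_lt0.
Qed.

End InverseRidge.

Section Comparison.
Variables (R : realType) (p : nat) (Sigma : 'M[R]_p.+1) (beta : 'cV[R]_p.+1).
Variables (s w : 'I_p.+1 -> R) (phi sigma2 sigma02 : R).
Hypothesis data : spectral_data Sigma beta s w.
Hypothesis s_gt0 : forall i, 0 < s i.
Hypothesis phi_gt0 : 0 < phi.
Hypothesis sigma2_ge0 : 0 <= sigma2.

Let m0 := mu_min Sigma phi.
Let l0 := lambda_min Sigma phi.
Let risk_at l := risk Sigma Sigma beta beta sigma2 sigma02 l phi.
Let w_ge0 := spectral_data_weight_ge0 data.

Lemma ridge_of_mu0 : ridge_of_mu s phi 0 = 0.
Proof.
by rewrite /ridge_of_mu big1 => [|i _]; rewrite ?mul0r // mulr0 subr0.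
Qed.

(** * The regime [phi < 1]: negative ridge levels are worse than 0 *)

Section Underparameterized.
Hypothesis phi_lt1 : phi < 1.
Hypothesis beta_neq0 : sigma2 = 0 -> beta <> 0.

Let m0_lt0 : m0 < 0. Proof. exact: (mu_min_lt0 data). Qed.

Let signal m := \sum_i w i * (s i / (s i + m) ^+ 2).

Let signal_ge m : m0 < m -> m <= 0 -> signal 0 <= signal m.
Proof.
move=> m0m m_le0; apply: ler_sum => i _.
have sm := mu_min_shifted_gt0 data s_gt0 phi_gt0 (ltW m0m) i.
rewrite ler_wpM2l // ler_pM2l // lef_pV2 ?posrE ?exprn_gt0 ?addr0 //.
by rewrite ler_sqr ?nnegrE ?(ltW sm) ?(ltW (s_gt0 i)) // gerDl.
Qed.

Let signal0_ge0 : 0 <= signal 0.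
Proof.
by apply: sumr_ge0 => i _; rewrite mulr_ge0 // divr_ge0 ?sqr_ge0 // ltW.
Qed.

Let signal0_gt0 : sigma2 = 0 -> 0 < signal 0.
Proof.
move=> /beta_neq0 /(spectral_data_weight_neq0 data) [j wj].
rewrite /signal (bigD1 j) //= ltr_wpDr //.
  by apply: sumr_ge0 => i _; rewrite mulr_ge0 // divr_ge0 ?sqr_ge0 // ltW.
by rewrite mulr_gt0 ?divr_gt0 ?exprn_gt0 ?addr0 // lt_def wj w_ge0.
Qed.

Lemma underparam_lambda_min_lt0 : lambda_min Sigma phi < 0.
Proof.
by rewrite (lambda_minE data) // -ridge_of_mu0 (ridge_of_mu_lt data).
Qed.

Let ridge_mu0 : ridge_mu Sigma 0 phi = 0.
Proof. by rewrite -{1}ridge_of_mu0 (ridge_of_muK data s_gt0 phi_gt0 _).2. Qed.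

(** After clearing denominators, the difference is [m ^+ 2 * signal m * (1 - phi) + sigma2 * (T -
    phi)] with [T > phi]. Both terms are nonnegative; the second is positive if [sigma2] is, and
    otherwise the first is, because [beta] is nonzero. *)
Lemma underparam_risk_lt (l : R) : lambda_min Sigma phi < l -> l < 0 ->
  risk_at 0 < risk_at l.
Proof.
move=> l0l l_lt0; have l0_lt0 := underparam_lambda_min_lt0.
rewrite /risk_at !(riskE data) // ridge_mu0 ltrD2r.
have [m0m _] := ridge_muP data s_gt0 phi_gt0 l0l.
have := ridge_mu_lt data s_gt0 phi_gt0 l0l l_lt0; rewrite ridge_mu0.
move: (ridge_mu Sigma l phi) m0m => m m0m m_lt0.
have T1 := mu_min_gcv_ratio_lt1 data s_gt0 phi_gt0 m0m.
have T0 := mu_min_gcv_ratio_decr data s_gt0 phi_gt0 (ltW m0m) m_lt0.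
have S0 := signal_ge m0m (ltW m_lt0).
rewrite /risk_of_mu -/(signal m) -/(signal 0) (gcv_ratio0 _ s_gt0) in T0 *.
rewrite expr0n mul0r add0r ltr_pdivrMr ?subr_gt0 // mulrAC ltr_pdivlMr ?subr_gt0 //.
have sig0 := sigma2_ge0; have phi1 := phi_lt1; have phi0 := phi_gt0.
move: (gcv_ratio s phi m) (signal m) (signal 0) T1 T0 S0 signal0_ge0 signal0_gt0.
move=> T S U T1 T0 SU U_ge0 U_gt0.
rewrite -subr_gt0.
have -> : (m ^+ 2 * S + sigma2 * T) * (1 - phi) - sigma2 * phi * (1 - T) =
  m ^+ 2 * S * (1 - phi) + sigma2 * (T - phi) by ring.
have m2 : 0 < m ^+ 2 by rewrite exprn_even_gt0 //= lt_eqF.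
have [/esym/U_gt0 U0|sig_neq0] := eqVneq 0 sigma2.
  rewrite ltr_wpDr ?mulr_ge0 ?subr_ge0 ?(ltW T0) //.
  by rewrite mulr_gt0 ?subr_gt0 // mulr_gt0 // (lt_le_trans U0 SU).
apply: ltr_wpDl.
  apply: mulr_ge0; last by rewrite subr_ge0 ltW.
  by apply: mulr_ge0; [exact: ltW|exact: le_trans SU].
by rewrite mulr_gt0 ?subr_gt0 // lt_def eq_sym sig_neq0.
Qed.

(** The numerator stays above a positive constant while the denominator [1 - T] tends to 0. *)
Lemma underparam_risk_blowup :
  (risk_at l)%:E @[l --> (lambda_min Sigma phi)^'+] --> +oo%E.
Proof.
apply/cvgeryP/cvgryPge => A.
(* A lower bound of the numerator for [m0 < m <= m0 / 2], where [m ^+ 2 >= (m0 / 2) ^+ 2],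
   [signal m >= signal 0] and [T >= phi]. *)
pose c := (m0 / 2) ^+ 2 * signal 0 + sigma2 * phi.
have c_gt0 : 0 < c.
  have m2 : 0 < (m0 / 2) ^+ 2.
    by rewrite exprn_even_gt0 //= mulf_neq0 ?invr_eq0 ?pnatr_eq0 // lt_eqF.
  have [/esym/signal0_gt0 S0|sig_neq0] := eqVneq 0 sigma2.
    by apply: ltr_wpDr; [apply: mulr_ge0 => //; exact: ltW|exact: mulr_gt0].
  apply: ltr_wpDl; first by apply: mulr_ge0 => //; exact: ltW.
  by rewrite mulr_gt0 // lt_def eq_sym sig_neq0.
pose B := `|A - sigma02| + 1.
have B_gt0 : 0 < B by rewrite ltr_wpDl.
have : 1 - c / B < gcv_ratio s phi m0.
  by rewrite (mu_minP data s_gt0 phi_gt0).2 ltrBlDr ltrDl divr_gt0.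
move=> /(cvgr_gt _ (mu_min_gcv_ratio_cont data s_gt0 phi_gt0)).
move=> /nbhs_ballP[e /= e_gt0 he].
(* Below [m1], [m] is within [e] of [m0], which gives [1 - T < c / B], and below [m0 / 2], which
   keeps [m ^+ 2] away from 0. *)
pose m1 := m0 + Num.min e (- m0 / 2).
have m0m1 : m0 < m1.
  by rewrite ltrDl lt_min e_gt0 divr_gt0 // oppr_gt0.
have m1e : m1 <= m0 + e by rewrite lerD2l ge_min lexx.
have m1_half : m1 <= m0 / 2.
  have : m1 <= m0 + (- m0 / 2) by rewrite lerD2l ge_min lexx orbT.
  lra.
have [l0l1 m1E] := ridge_of_muK data s_gt0 phi_gt0 m0m1.
near=> l.
have l0l : lambda_min Sigma phi < l by near: l; exact: nbhs_right_gt.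
have ll1 : l < ridge_of_mu s phi m1 by near: l; exact: nbhs_right_lt.
rewrite /risk_at (riskE data) // -lerBlDr.
have [m0m _] := ridge_muP data s_gt0 phi_gt0 l0l.
have := ridge_mu_lt data s_gt0 phi_gt0 l0l ll1; rewrite m1E.
move: (ridge_mu Sigma l phi) m0m => m m0m mm1.
have mlt0 := m0_lt0.
have m_lt0 : m < 0 by lra.
have T1 := mu_min_gcv_ratio_lt1 data s_gt0 phi_gt0 m0m.
have T0 := mu_min_gcv_ratio_decr data s_gt0 phi_gt0 (ltW m0m) m_lt0.
have S0 := signal_ge m0m (ltW m_lt0).
have Tm : 1 - c / B < gcv_ratio s phi m.
  apply: he; rewrite /ball /= ltr0_norm ?subr_lt0 // opprB ltrBlDl.
  exact: lt_le_trans mm1 m1e.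
rewrite (gcv_ratio0 _ s_gt0) in T0.
rewrite /risk_of_mu -/(signal m) ler_pdivlMr ?subr_gt0 //.
have half : (m0 / 2) ^+ 2 <= m ^+ 2.
  by rewrite -sqrrN -[leRHS]sqrrN ler_sqr ?nnegrE; lra.
have c_le : c <= m ^+ 2 * signal m + sigma2 * gcv_ratio s phi m.
  apply: lerD; last by rewrite ler_wpM2l // ltW.
  by rewrite ler_pM ?sqr_ge0.
apply: le_trans c_le.
apply: (@le_trans _ _ (B * (1 - gcv_ratio s phi m))).
  by rewrite ler_pM2r ?subr_gt0 // (le_trans (ler_norm _)) // lerDl.
by rewrite mulrC -ler_pdivlMr // lerBlDr -lerBlDl ltW.
Unshelve. all: by end_near. Qed.

End Underparameterized.

(** * The regime [phi > 1]: nonnegative ridge levels are not optimal under alignment *)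

Section Overparameterized.
Hypothesis phi_gt1 : 1 < phi.

Let m0_gt0 : 0 < m0. Proof. exact: (mu_min_gt0 data). Qed.

Let mu0 := ridge_mu Sigma 0 phi.
Let F := inv_risk s w phi sigma2.

Lemma shrink_denom_inv (m : R) : 0 < m ->
  shrink_denom s phi m^-1 = 1 - gcv_ratio s phi m.
Proof.
move=> m_gt0; rewrite /shrink_denom /gcv_ratio; congr (_ - _ * (_ / _)).
apply: eq_bigr => i _; congr (_ ^+ 2); rewrite /shrink.
have si := s_gt0 i; have si_m : 0 < m + s i by rewrite addr_gt0.
by field; rewrite (gt_eqF m_gt0) [s i + m]addrC ?[_ + m]addrC !gt_eqF // addrC.
Qed.

Lemma ridge_of_mu_inv (m : R) : 0 < m ->
  ridge_of_mu s phi m = m - phi * shrink_mean s 1 m^-1.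
Proof.
move=> m_gt0; rewrite /ridge_of_mu /shrink_mean; congr (_ - _ * (_ / _)).
apply: eq_bigr => i _; rewrite /shrink.
have si := s_gt0 i; have si_m : 0 < m + s i by rewrite addr_gt0.
by field; rewrite (gt_eqF m_gt0) [s i + m]addrC ?[_ + m]addrC !gt_eqF // addrC.
Qed.

(** At [v = 1 / m] the factor [m / (s + m)] is [shrink], and [sigma2 * T / (1 - T) = sigma2 / (1 -
    T) - sigma2]. *)
Lemma risk_of_mu_inv (m : R) : mu_min Sigma phi < m ->
  risk_of_mu s w phi sigma2 m = inv_risk s w phi sigma2 m^-1 - sigma2.
Proof.
move=> m0m; have m_gt0 : 0 < m by exact: lt_trans m0m.
have T1 := mu_min_gcv_ratio_lt1 data s_gt0 phi_gt0 m0m.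
rewrite /risk_of_mu /inv_risk shrink_denom_inv //.
have -> : m ^+ 2 * (\sum_i w i * (s i / (s i + m) ^+ 2)) =
    shrink_signal s w 2 m^-1.
  rewrite mulr_sumr; apply: eq_bigr => i _; rewrite /shrink.
  have si := s_gt0 i; have si_m : 0 < m + s i by rewrite addr_gt0.
  by field; rewrite (gt_eqF m_gt0) [s i + m]addrC ?[_ + m]addrC !gt_eqF // addrC.
by move: (gcv_ratio _ _ _) T1 => T T1; field; rewrite gt_eqF // subr_gt0.
Qed.

(** Multiplying [m0] by [1 = gcv_ratio m0] expresses it through the squares of [x = s / (s + m0)];
    as [m0 > 0], each [x] lies strictly between 0 and 1, so [x ^+ 2 < x]. *)
Lemma overparam_lambda_min_lt0 : lambda_min Sigma phi < 0.
Proof.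
rewrite (lambda_minE data) // /ridge_of_mu subr_lt0 -/m0.
rewrite -[ltLHS]mulr1 -{1}(mu_minP data s_gt0 phi_gt0).2 -/m0 /gcv_ratio.
rewrite mulrCA ltr_pM2l // mulrA ltr_pM2r ?invr_gt0 ?ltr0n // mulr_sumr.
apply: ltr_sum => [|i _].
  by apply/hasP; exists ord0; rewrite ?mem_index_enum.
have si := s_gt0 i; rewrite ltr_pM2l // expr2.
have sm : 0 < s i + m0 by rewrite addr_gt0.
by rewrite gtr_pMl ?divr_gt0 // ltr_pdivrMr // mul1r ltrDl.
Qed.

Let mu0P : mu_min Sigma phi < mu0 /\ ridge_of_mu s phi mu0 = 0.
Proof.
exact: (ridge_muP data s_gt0 phi_gt0 overparam_lambda_min_lt0).
Qed.

Lemma risk_inv (l : R) : lambda_min Sigma phi < l ->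
  risk_at l = inv_risk s w phi sigma2 (ridge_mu Sigma l phi)^-1
              - sigma2 + sigma02.
Proof.
move=> l0l; have [m0m _] := ridge_muP data s_gt0 phi_gt0 l0l.
by rewrite /risk_at (riskE data) // risk_of_mu_inv.
Qed.

Lemma alignment_aligned (v : R) : 0 <= v ->
  alignment Sigma beta sigma2 v -> aligned s w sigma2 v.
Proof.
move=> v_ge0; rewrite /alignment /aligned /=.
have vs i : v * s i + 1 != 0.
  by rewrite gt_eqF // ltr_wpDl // mulr_ge0 // ltW.
rewrite !(trbar_power data) // !(trbar_signal_power data) //.
have E k : \sum_i s i / (v * s i + 1) ^+ k = \sum_i s i * shrink s v i ^+ k.
  by apply: eq_bigr => i _; rewrite /shrink exprVn.
have E' k : \sum_i w i * (s i / (v * s i + 1) ^+ k) = shrink_signal s w k v.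
  by apply: eq_bigr => i _; rewrite /shrink exprVn.
by rewrite !E !E'.
Qed.

Hypothesis align_lt : forall v : R, 0 < v < 1 / ridge_mu Sigma 0 phi ->
  alignment Sigma beta sigma2 v.
Hypothesis align_end : sigma2 = 0 ->
  alignment Sigma beta sigma2 (1 / ridge_mu Sigma 0 phi).

Let mu0_gt0 : 0 < mu0. Proof. exact: lt_trans mu0P.1. Qed.

Let v0_gt0 : 0 < mu0^-1. Proof. by rewrite invr_gt0. Qed.

Let denom_gt0 v : 0 <= v <= mu0^-1 -> 0 < shrink_denom s phi v.
Proof.
move=> /andP[]; rewrite le_eqVlt => /predU1P[<-|v_gt0] vv0.
  rewrite /shrink_denom big1 ?mul0r ?mulr0 ?subr0 // => i _.
  by rewrite /shrink mul0r add0r invr1 subrr expr0n.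
rewrite -[v]invrK shrink_denom_inv ?invr_gt0 // subr_gt0.
apply: (mu_min_gcv_ratio_lt1 data) => //.
by apply: lt_le_trans mu0P.1 _; rewrite -[mu0]invrK lef_pV2 ?posrE.
Qed.

(** This says that the ridge level at [m = v^-1] is nonnegative, which holds because [m >= mu0]. *)
Let mean_le1 v : 0 < v <= mu0^-1 -> v * phi * shrink_mean s 1 v <= 1.
Proof.
move=> /andP[v_gt0 vv0].
have mu0v : mu0 <= v^-1 by rewrite -[mu0]invrK lef_pV2 ?posrE.
have : 0 <= ridge_of_mu s phi v^-1.
  move: mu0v; rewrite le_eqVlt -mu0P.2 => /predU1P[->//|h].
  by rewrite ltW // (ridge_of_mu_lt data) // ltW // mu0P.1.
rewrite ridge_of_mu_inv ?invr_gt0 // invrK subr_ge0 => h.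
by rewrite -mulrA mulrC -ler_pdivlMr // mul1r.
Qed.

Let decr := inv_risk_decr s_gt0 w_ge0 phi_gt0 sigma2_ge0 v0_gt0 denom_gt0 mean_le1.

Let al v : 0 < v < mu0^-1 -> aligned s w sigma2 v.
Proof.
move=> vP; apply: alignment_aligned; first by case/andP: vP => /ltW.
by apply: align_lt; rewrite mul1r.
Qed.

Let al_end : sigma2 = 0 -> aligned s w sigma2 mu0^-1.
Proof.
move=> /align_end; rewrite mul1r => h.
by apply: alignment_aligned h; exact: ltW.
Qed.

Lemma overparam_risk_gt (l : R) : 0 < l -> risk_at 0 < risk_at l.
Proof.
move=> l_gt0; have l00 := overparam_lambda_min_lt0.
rewrite (risk_inv l00) (risk_inv (lt_trans l00 l_gt0)) !ltrD2r.
have mu0l := ridge_mu_lt data s_gt0 phi_gt0 l00 l_gt0.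
have m_gt0 := lt_trans mu0_gt0 mu0l.
apply: (decr al al_end) => //; first by rewrite invr_ge0 ltW.
by rewrite ltf_pV2 ?posrE.
Qed.

(** For [l > 0], [ridge_mu] is at least [l], so its inverse tends to 0 and the risk tends to its
    value at [v = 0], which is larger than the value at [mu0^-1] by monotonicity. *)
Lemma overparam_risk_limit_gt :
  exists2 L, risk_at 0 < L & (risk_at l)%:E @[l --> +oo] --> L%:E.
Proof.
exists (F 0 - sigma2 + sigma02).
  rewrite risk_inv ?overparam_lambda_min_lt0 // ltrD2r ltrD2r.
  exact: (decr al al_end).
apply: cvg_EFin; first by near=> l.
have mu_inv : (ridge_mu Sigma l phi)^-1 @[l --> +oo] --> (0 : R).
  apply: (@squeeze_cvgr _ _ _ _ (fun=> 0) (fun l : R => l^-1)); last 2 first.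
  - exact: cvg_cst.
  - apply: (@gtr0_cvgV0 _ _ _ _ (fun x : R => x) _).2; last exact: cvg_id.
    exact: nbhs_pinfty_gt.
  near=> l.
  have l_gt0 : 0 < l by near: l; exact: nbhs_pinfty_gt.
  have [m0m mE] := ridge_muP data s_gt0 phi_gt0
    (lt_trans overparam_lambda_min_lt0 l_gt0).
  have m_gt0 : 0 < ridge_mu Sigma l phi by exact: lt_trans m0m.
  rewrite invr_ge0 (ltW m_gt0) lef_pV2 ?posrE //= -{1}mE ridge_of_mu_inv //.
  rewrite gerBl mulr_ge0 ?(ltW phi_gt0) // ltW //.
  by apply: shrink_mean_gt0 => //; rewrite invr_ge0 ltW.
have F0 : {for 0, continuous F}.
  apply: inv_risk_cont => //.
  by rewrite gt_eqF // denom_gt0 // lexx ltW.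
have := cvg_comp _ _ mu_inv F0 => FF.
pose G l := F (ridge_mu Sigma l phi)^-1 - sigma2 + sigma02.
have GE : {near +oo, G =1 (fine \o (fun l => (risk_at l)%:E))}.
  near=> l; rewrite /G /= (risk_inv (l := l)) //.
  apply: lt_trans overparam_lambda_min_lt0 _.
  by near: l; exact: nbhs_pinfty_gt.
apply: cvg_trans (near_eq_cvg GE) _.
apply: cvgD; last exact: cvg_cst.
by apply: cvgB; last exact: cvg_cst.
Unshelve. all: by end_near. Qed.

(** The derivative is still negative at [mu0^-1], so a slightly larger [v] lowers the risk
    further. *)
Lemma overparam_better :
  exists2 l, lambda_min Sigma phi < l & risk_at l < risk_at 0.
Proof.
have [e e_gt0 he] := inv_risk_decr_right s_gt0 w_ge0 phi_gt0 sigma2_ge0 v0_gt0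
  denom_gt0 mean_le1 al al_end.
have d_gt0 : 0 < m0^-1 - mu0^-1.
  by rewrite subr_gt0 ltf_pV2 ?posrE // mu0P.1.
(* The bound by [m0^-1 - mu0^-1] keeps [(mu0^-1 + h)^-1] above [mu_min]; halving makes both bounds
   strict. *)
pose h := Num.min e (m0^-1 - mu0^-1) / 2.
have h_gt0 : 0 < h by rewrite divr_gt0 // lt_min e_gt0.
have h_e : h < e.
  have : Num.min e (m0^-1 - mu0^-1) <= e by rewrite ge_min lexx.
  by rewrite /h; lra.
have h_d : h < m0^-1 - mu0^-1.
  have : Num.min e (m0^-1 - mu0^-1) <= m0^-1 - mu0^-1 by rewrite ge_min lexx orbT.
  by move: d_gt0; rewrite /h; lra.
have v_gt0 : 0 < mu0^-1 + h by rewrite addr_gt0.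
have m0m : m0 < (mu0^-1 + h)^-1.
  by rewrite -[m0]invrK ltf_pV2 ?posrE ?invr_gt0 // -ltrBrDl.
have [l0l mE] := ridge_of_muK data s_gt0 phi_gt0 m0m.
exists (ridge_of_mu s phi (mu0^-1 + h)^-1) => //.
rewrite !risk_inv ?overparam_lambda_min_lt0 // mE invrK ltrD2r ltrD2r.
by apply: he; rewrite h_gt0.
Qed.

End Overparameterized.
End Comparison.

(** If [sigma2 = 0] and [beta = 0], the risk is constant and every level is a minimizer, hence the
    nondegeneracy condition in the first part. If [sigma2 = 0], alignment on the open interval
    passes to its right end only as a weak inequality, hence the condition there in the second
    part. *)
Theorem theorem1 (R : realType) (p : nat) (a b : R)
    (Sigma Sigma0 : 'M[R]_p.+1) (beta beta0 : 'cV[R]_p.+1)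
    (sigma2 sigma02 phi : R) (lambda_star : \bar R)
    (ha : 0 < a)
    (hSigma : covariance_in a b Sigma) (hSigma0 : covariance_in a b Sigma0)
    (hsigma2 : 0 <= sigma2) (hsigma02 : 0 <= sigma02) (hphi : 0 < phi)
    (in_dist : (Sigma0, beta0) = (Sigma, beta))
    (hstar : is_argmin
       [set l : \bar R | ((lambda_min Sigma phi)%:E <= l)%E]
       (ext_risk Sigma Sigma0 beta beta0 sigma2 sigma02 phi) lambda_star) :
  (phi < 1 ->
   (sigma2 = 0 -> beta <> 0) ->
   (0 <= lambda_star)%E) /\
  (1 < phi ->
   (forall v : R, 0 < v < 1 / ridge_mu Sigma 0 phi ->
      alignment Sigma beta sigma2 v) ->
   (sigma2 = 0 -> alignment Sigma beta sigma2 (1 / ridge_mu Sigma 0 phi)) ->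
   (lambda_star < 0)%E).
Proof.
have {in_dist}[E1 E2] := in_dist; subst Sigma0 beta0.
have [s [w data]] := spectral_data_exists beta hSigma.1.
have s_gt0 i : 0 < s i.
  have /hSigma.2/andP[ai _] : eigenvalue Sigma (s i).
    by apply/(spectral_data_eigenvalue data); exists i.
  exact: lt_le_trans ai.
case: hstar => star_ge star_min; split=> [phi_lt1 beta_neq0|phi_gt1 al_lt al_end].
  have l0_lt0 := underparam_lambda_min_lt0 data s_gt0 hphi phi_lt1.
  have := star_min 0%:E; rewrite /= lee_fin (ltW l0_lt0) gt_eqF // => /(_ isT).
  case: lambda_star star_ge {star_min} => [l| |] //=.
  rewrite !lee_fin => l0l; case: eqP => [_|/eqP l_neq].
    (* At [lambda_min] the extended risk is [+oo], which is not below the finite risk at 0. *)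
    rewrite (cvg_lim _ (underparam_risk_blowup sigma02 data s_gt0 hphi hsigma2
      phi_lt1 beta_neq0)) //.
  have l0_lt_l : lambda_min Sigma phi < l by rewrite lt_neqAle eq_sym l_neq.
  rewrite lee_fin => risk_le; rewrite leNgt; apply/negP => l_lt0.
  have := underparam_risk_lt sigma02 data s_gt0 hphi hsigma2 phi_lt1 beta_neq0
    l0_lt_l l_lt0.
  by rewrite ltNge risk_le.
have l0_lt0 := overparam_lambda_min_lt0 data s_gt0 hphi phi_gt1.
have := star_min 0%:E; rewrite /= lee_fin (ltW l0_lt0) gt_eqF // => /(_ isT).
case: lambda_star star_ge star_min => [l| |] //= l0l star_min risk_le; last first.
  (* The value at [+oo] is a limit strictly above the risk at 0. *)
  have [L risk_lt /cvg_lim limE] := overparam_risk_limit_gt sigma02 data s_gt0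
    hphi hsigma2 phi_gt1 al_lt al_end.
  by move: risk_le; rewrite limE // lee_fin leNgt risk_lt.
rewrite lte_fin ltNge; apply/negP => l_ge0.
have l_neq : (l == lambda_min Sigma phi) = false.
  by rewrite gt_eqF // (lt_le_trans l0_lt0).
move: risk_le star_min; rewrite l_neq lee_fin => risk_le star_min.
move: l_ge0; rewrite le_eqVlt => /predU1P[l_eq0|l_gt0]; last first.
  have := overparam_risk_gt sigma02 data s_gt0 hphi hsigma2 phi_gt1 al_lt al_end
    l_gt0.
  by rewrite ltNge risk_le.
(* The remaining case is a minimizer equal to 0, which is beaten by another admissible level. *)
have [m l0m] := overparam_better sigma02 data s_gt0 hphi hsigma2 phi_gt1 al_lt
  al_end.
have := star_min m%:E; rewrite /= lee_fin (ltW l0m) gt_eqF // => /(_ isT).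
by rewrite lee_fin -l_eq0 leNgt => /negP.
Qed.
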